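(* There exists a planar graph with $75$ vertices which is not $4$-choosable.
   Context: All graphs are finite, undirected and simple. A graph $G=(V,E)$ is $k$-choosable if for every assignment of sets $S(v)\subseteq\mathbb{Z}$ with $|S(v)|=k$ for all $v\in V$, there is a proper vertex coloring $c:V\to\mathbb{Z}$ with $c(v)\in S(v)$ for all $v\in V$. *)

(* Defs.v *)
From HB Require Import structures.
From mathcomp Require Import all_boot all_order all_algebra finmap.
From mathcomp Require Import all_classical all_reals all_analysis.

Set Implicit Arguments.
Unset Strict Implicit.
Unset Printing Implicit Defensive.

Import Order.TTheory GRing.Theory Num.Theory.
Import numFieldNormedType.Exports.

Local Open Scope classical_set_scope.
Local Open Scope ring_scope.

Record sgraph := SGraph {
  vertex :> finType;
  adj : rel vertex;
  adj_sym : symmetric adj;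
  adj_irrefl : irreflexive adj
}.

Definition edges (G : sgraph) : {set {set G}} :=
  [set [set uv.1; uv.2] | uv : G * G & adj uv.1 uv.2]%SET.

Definition choosable (k : nat) (G : sgraph) : Prop :=
  forall S : G -> {fset int},
    (forall v, #|` S v|%fset = k) ->
    exists c : G -> int,
      (forall u v, adj u v -> c u <> c v) /\ (forall v, c v \in S v).

Definition is_arc (R : realType) (A : set (R * R)) (a b : R * R) : Prop :=
  exists f : R -> R * R,
    [/\ {within `[0, 1], continuous f},
        {in `[0, 1] &, injective f},
        f 0 = a,
        f 1 = b
      & f @` `[0, 1] = A].

Definition arc_interior (R : realType) (G : sgraph) (pos : G -> R * R)
    (arc : {set G} -> set (R * R)) (e : {set G}) : set (R * R) :=
  arc e `\` [set pos v | v in [set` e]].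

(* Arcs are indexed by the unordered pair of ends, so that each undirected edge
   is drawn once; the values of [arc] outside [edges G] are irrelevant. *)
Definition plane_drawing (R : realType) (G : sgraph) (pos : G -> R * R)
    (arc : {set G} -> set (R * R)) : Prop :=
  [/\ injective pos,
      forall u v, adj u v -> is_arc (arc [set u; v]%SET) (pos u) (pos v),
      forall e w, e \in edges G -> ~ arc_interior pos arc e (pos w)
    & forall e e', e \in edges G -> e' \in edges G -> e != e' ->
        arc_interior pos arc e `&` arc e' = set0].

Definition planar (R : realType) (G : sgraph) : Prop :=
  exists (pos : G -> R * R) (arc : {set G} -> set (R * R)),
    plane_drawing pos arc.

(* Main.v *)
Require Import Defs.
From HB Require Import structures.
From Stdlib Require Import ZArith.
From mathcomp Require Import all_boot all_order all_algebra finmap.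
From mathcomp Require Import all_classical all_reals all_analysis.
From mathcomp Require Import ssrZ zify ring lra.

Set Implicit Arguments.
Unset Strict Implicit.
Unset Printing Implicit Defensive.

Import Order.TTheory GRing.Theory Num.Theory.
Import numFieldNormedType.Exports.

Local Open Scope classical_set_scope.
Local Open Scope ring_scope.

(* Join two adjacent poles u, v to thirteen common neighbours x_0, ..., x_12 and
   give all of these the list {0, 1, 2, 3}.  The twelve quadrilaterals
   u x_i v x_(i+1) correspond to the twelve ordered pairs (a, b) of distinct
   colors of the poles; the quadrilateral of (a, b) has five inner vertices which
   cannot be colored when u, v get the colors a, b.  Indeed x_i takes one of the
   two other colors c, d, so the adjacent neighbours p, q of x_i, with lists
   {a, c, d, 4} and {b, c, d, 4}, use up the color 4; symmetrically the two
   neighbours of x_(i+1) use up 5.  All four are adjacent to a vertex z with list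
   {a, b, 4, 5} which is also adjacent to u and v, hence z has no color left.
   Planarity is witnessed by a straight-line drawing with integer coordinates, in
   which crossings are excluded by the signs of orientation determinants. *)

(** * Orientation determinants and segments *)

(** Twice the signed area of the triangle [p q r]. The ring is a parameter so that determinants can
    be computed in [Z] and used in [R]. *)
Definition orient (K : pzRingType) (p q r : K * K) : K :=
  (q.1 - p.1) * (r.2 - p.2) - (q.2 - p.2) * (r.1 - p.1).

Lemma orient_rmorph (K L : pzRingType) (f : {rmorphism K -> L}) (p q r : K * K) :
  orient (f p.1, f p.2) (f q.1, f q.2) (f r.1, f r.2) = f (orient p q r).
Proof. by rewrite /orient !(rmorphB, rmorphM). Qed.

Definition segment_point (R : realType) (a b : R * R) (t : R) : R * R :=
  (a.1 + t * (b.1 - a.1), a.2 + t * (b.2 - a.2)).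

Definition segment (R : realType) (a b : R * R) : set (R * R) :=
  segment_point a b @` `[0, 1].

Lemma segment_sym (R : realType) (a b : R * R) : segment a b = segment b a.
Proof.
suff H c d : segment c d `<=` @segment R d c by apply/seteqP; split; exact: H.
move=> p [t]; rewrite /= in_itv /= => /andP[t0 t1] <-; exists (1 - t).
  by rewrite /= in_itv /=; apply/andP; split; lra.
by rewrite /segment_point; congr pair; ring.
Qed.

Lemma segment_is_arc (R : realType) (a b : R * R) :
  a <> b -> is_arc (segment a b) a b.
Proof.
move=> ab; exists (segment_point a b); split => //.
- have cts (x y : R) : continuous (fun t : R => x + t * (y - x)).
    by move=> t; apply: cvgD; [exact: cvg_cst | exact: (cvgMr_tmp (f := id))].
  apply: continuous_subspaceT => t.
  exact: cvg_pair (cts a.1 b.1 t) (cts a.2 b.2 t).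
- move=> s t _ _ [/addrI e1 /addrI e2]; apply: contrapT => st; apply: ab.
  have {}st : s - t != 0 by rewrite subr_eq0; apply/eqP.
  rewrite (surjective_pairing a) (surjective_pairing b); congr pair;
    apply/esym/eqP; rewrite -subr_eq0 -(mulrI_eq0 _ (mulfI st)) mulrBl;
    by rewrite ?e1 ?e2 subrr.
- by rewrite /segment_point !mul0r !addr0 -surjective_pairing.
- by rewrite /segment_point !mul1r ![_ + (_ - _)]addrC !subrK -surjective_pairing.
Qed.

Lemma orient_segment_point (R : realType) (a b c d : R * R) (t : R) :
  orient a b (segment_point c d t) = (1 - t) * orient a b c + t * orient a b d.
Proof. rewrite /orient /segment_point /=; ring. Qed.

Lemma orient_segment (R : realType) (a b p : R * R) :
  segment a b p -> orient a b p = 0.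
Proof. by case=> t _ <-; rewrite orient_segment_point /orient; ring. Qed.

(** A segment with both ends strictly on one side of a line misses the line. Multiplying the convex
    combination by one end value [x] leaves [x * x] and [x * y], both positive, so no case split on
    the side is needed. *)
Lemma orient_segment_neq0 (R : realType) (a b c d p : R * R) :
  0 < orient a b c * orient a b d -> segment c d p -> orient a b p != 0.
Proof.
move=> cd [t]; rewrite /= in_itv /= => /andP[t0 t1] <-.
rewrite orient_segment_point.
move: (orient a b c) (orient a b d) cd => x y xy.
have x0 : x != 0 by apply: contraTneq xy => ->; rewrite mul0r ltxx.
have x2 : 0 < x * x by rewrite -expr2 exprn_even_gt0.
suff : 0 < x * ((1 - t) * x + t * y).
  by apply: contraTneq => ->; rewrite mulr0 ltxx.
have -> : x * ((1 - t) * x + t * y) = (1 - t) * (x * x) + t * (x * y) by ring.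
have [->|tn0] := eqVneq t 0; first by rewrite subr0 mul1r mul0r addr0.
have {tn0}t0 : 0 < t by rewrite lt_def tn0.
by apply: ltr_wpDl; [apply: mulr_ge0; lra | apply: mulr_gt0].
Qed.

(** The determinant grows linearly from zero along the second segment, so it vanishes only at the
    common end. *)
Lemma segment_meet_end (R : realType) (a b c p : R * R) :
  orient a b c != 0 -> segment a b p -> segment a c p -> p = a.
Proof.
move=> abc /orient_segment abp [t _ pE]; move: abp.
rewrite -pE orient_segment_point.
rewrite [orient a b a](_ : _ = 0); last by rewrite /orient; ring.
rewrite mulr0 add0r => /eqP; rewrite mulf_eq0 (negPf abc) orbF => /eqP ->.
by rewrite /segment_point !mul0r !addr0 -surjective_pairing.
Qed.

(** * Straight-line drawings *)

Lemma set2_eq (T : finType) (a b c d : T) :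
  [set a; b]%SET = [set c; d]%SET -> (a = c /\ b = d) \/ (a = d /\ b = c).
Proof.
move=> e; have /set2P[aE|aE] : a \in [set c; d]%SET by rewrite -e set21.
  have /set2P[bE|->] : b \in [set c; d]%SET by rewrite -e set22.
    have /set2P[|] : d \in [set a; b]%SET by rewrite e set22.
      by rewrite aE bE => ->; left.
    by move=> ->; left.
  by left.
have /set2P[->|bE] : b \in [set c; d]%SET by rewrite -e set22.
  by right.
have /set2P[|] : c \in [set a; b]%SET by rewrite e set21.
  by rewrite aE bE => ->; right.
by move=> ->; right.
Qed.

(** Edges with a common end meet only there, by non-collinearity; for disjoint edges, the line
    through one of them leaves the other strictly on one side. *)
Lemma straight_line_planar (R : realType) (G : sgraph) (pos : G -> R * R) :
  injective pos ->
  (forall u v w, adj u v -> w != u -> w != v ->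
     orient (pos u) (pos v) (pos w) != 0) ->
  (forall u v w x, adj u v -> adj w x -> uniq [:: u; v; w; x] ->
     0 < orient (pos u) (pos v) (pos w) * orient (pos u) (pos v) (pos x) \/
     0 < orient (pos w) (pos x) (pos u) * orient (pos w) (pos x) (pos v)) ->
  planar R G.
Proof.
move=> posI vtx sep.
(* An unordered pair does not say which end comes first; the union over both orders avoids a choice,
   and [segment_sym] makes it a single segment. *)
pose arc (e : {set G}) : set (R * R) :=
  [set p | exists u v, [/\ adj u v, e = [set u; v]%SET
                         & segment (pos u) (pos v) p]].
have arcE u v : adj u v -> arc [set u; v]%SET = segment (pos u) (pos v).
  move=> uv; apply/seteqP; split => [p [u' [v' [_ /set2_eq + ]]]|p uvp].
    by case=> -[-> ->] //; rewrite segment_sym.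
  by exists u, v.
have edgeP e : e \in edges G -> exists u v, adj u v /\ e = [set u; v]%SET.
  by case/imsetP => -[u v]; rewrite inE => /= uv ->; exists u, v.
have neqI u v : adj u v -> u != v.
  by apply: contraTneq => ->; rewrite adj_irrefl.
exists pos, arc; split=> //.
- move=> u v uv; rewrite arcE //; apply: segment_is_arc => /posI.
  by apply/eqP/neqI.
- move=> e w /edgeP[u [v [uv ->]]] [] /=; rewrite arcE // => uvw ends.
  have [wu|wu] := eqVneq w u.
    by apply: ends; exists w; rewrite ?wu ?inE ?eqxx.
  have [wv|wv] := eqVneq w v.
    by apply: ends; exists w; rewrite ?wv ?inE ?eqxx ?orbT.
  by have := vtx _ _ _ uv wu wv; rewrite (orient_segment uvw) eqxx.
- move=> e e' /edgeP[u [v [uv ->]]] /edgeP[w [x [wx ->]]] ee'.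
  apply/seteqP; split=> // p [[/=]]; rewrite !arcE // => uvp ends wxp.
  have [pu pv] : p <> pos u /\ p <> pos v.
    by split=> pE; apply: ends; rewrite pE; [exists u | exists v];
      rewrite ?inE ?eqxx ?orbT.
  have shared c d f : adj c d -> adj c f -> f != d -> p <> pos c ->
      segment (pos c) (pos d) p -> segment (pos c) (pos f) p -> False.
    move=> cd cf fd pc pcd pcf; apply: pc; apply: segment_meet_end pcd pcf.
    by apply: vtx => //; rewrite eq_sym; exact: neqI.
  have [vu xw] : adj v u /\ adj x w by split; rewrite adj_sym.
  have [E|uw] := eqVneq u w.
    subst w; apply: (shared u v x) => //.
    by apply: contraNneq ee' => ->.
  have [E|ux] := eqVneq u x.
    subst x; apply: (shared u v w) => //; last by rewrite segment_sym.
    by apply: contraNneq ee' => ->; rewrite finset.setUC.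
  have [E|vw] := eqVneq v w.
    subst w; apply: (shared v u x) => //; last by rewrite segment_sym.
    by apply: contraNneq ee' => ->; rewrite finset.setUC.
  have [E|vx] := eqVneq v x.
    subst x; apply: (shared v u w) => //; try by rewrite segment_sym.
    by apply: contraNneq ee' => ->.
  have /(sep _ _ _ _ uv wx)[] : uniq [:: u; v; w; x].
    by rewrite /= !inE !negb_or uw ux vw vx !neqI.
  + by move=> /orient_segment_neq0/(_ wxp); rewrite (orient_segment uvp) eqxx.
  + by move=> /orient_segment_neq0/(_ uvp); rewrite (orient_segment wxp) eqxx.
Qed.

(** * Planarity certificates over the integers *)

Definition embZ (R : realType) (z : Z) : R := (int_of_Z z)%:~R.

HB.instance Definition _ (R : realType) :=
  GRing.RMorphism.copy (@embZ R) (intr \o int_of_Z).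

Lemma embZ_inj (R : realType) : injective (@embZ R).
Proof. by move=> a b /intr_inj/(can_inj int_of_ZK). Qed.

Lemma embZ_gt0 (R : realType) (z : Z) : 0 < z -> 0 < embZ R z.
Proof. by rewrite /embZ ltr0z; case: z => //= p _; rewrite ltz_nat; lia. Qed.

Definition arc_rel (n : nat) (s : seq (nat * nat)) : rel 'I_n :=
  fun u v => (val u, val v) \in s.

Lemma arc_rel_sym (n : nat) (s : seq (nat * nat)) :
  all (fun e => (e.2, e.1) \in s) s -> symmetric (@arc_rel n s).
Proof. by move=> /allP sym u v; apply/idP/idP => /sym. Qed.

Lemma arc_rel_irrefl (n : nat) (s : seq (nat * nat)) :
  all (fun e => e.1 != e.2) s -> irreflexive (@arc_rel n s).
Proof. by move=> /allP irr u; apply/negP => /irr; rewrite eqxx. Qed.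

(* Conditionals replace boolean connectives because the latter are strict under
   call-by-value evaluation. *)
Definition separated (ps : seq (nat * (Z * Z)))
    (es : seq ((nat * (Z * Z)) * (nat * (Z * Z)))) : bool :=
  all (fun e =>
    all (fun w => if w.1 == e.1.1 then true else if w.1 == e.2.1 then true else
           orient e.1.2 e.2.2 w.2 != 0) ps &&
    all (fun f =>
           if ~~ uniq [:: e.1.1; e.2.1; f.1.1; f.2.1] then true else
           if 0 < orient e.1.2 e.2.2 f.1.2 * orient e.1.2 e.2.2 f.2.2 then true
           else 0 < orient f.1.2 f.2.2 e.1.2 * orient f.1.2 f.2.2 e.2.2) es) es.

(** The embedding of [Z] into [R] commutes with [orient] and preserves positivity and nonvanishing,
    so a check evaluated in [Z] suffices. *)
Lemma separated_planar (R : realType) (n : nat) (s : seq (nat * nat))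
    (pt : nat -> Z * Z) (s_sym : symmetric (@arc_rel n s))
    (s_irr : irreflexive (@arc_rel n s)) :
  uniq [seq pt i | i <- iota 0 n] ->
  separated [seq (i, pt i) | i <- iota 0 n]
    [seq ((e.1, pt e.1), (e.2, pt e.2)) | e <- s] ->
  planar R (SGraph s_sym s_irr).
Proof.
move=> pt_uniq /allP sep.
pose pos (u : 'I_n) : R * R := (embZ R (pt u).1, embZ R (pt u).2).
have iotaP (u : 'I_n) : val u \in iota 0 n by rewrite mem_iota ltn_ord.
have orientE (u v w : 'I_n) :
    orient (pos u) (pos v) (pos w) = embZ R (orient (pt u) (pt v) (pt w)).
  exact: (orient_rmorph (@embZ R)).
apply: (@straight_line_planar R (SGraph s_sym s_irr) pos).
- move=> u v [/embZ_inj e1 /embZ_inj e2]; apply/val_inj.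
  have e : pt u = pt v.
    by rewrite (surjective_pairing (pt u)) e1 e2 -surjective_pairing.
  have := @nth_uniq _ (0, 0) _ u v _ _ pt_uniq; rewrite !size_map size_iota.
  move=> /(_ (ltn_ord u) (ltn_ord v)).
  rewrite !(nth_map 0%N) ?size_iota // !nth_iota // !add0n e eqxx.
  by move=> /esym/eqP.
- move=> u v w /(map_f (fun e => ((e.1, pt e.1), (e.2, pt e.2))))/sep.
  move=> /andP[/allP/(_ _ (map_f (fun i => (i, pt i)) (iotaP w))) /= + _].
  rewrite !val_eqE => + /negPf wu /negPf wv; rewrite wu wv orientE => uvw.
  by rewrite -(rmorph0 (@embZ R)) (inj_eq (@embZ_inj R)).
- move=> u v w x /(map_f (fun e => ((e.1, pt e.1), (e.2, pt e.2))))/sep.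
  move=> /andP[_ /allP uvP].
  move=> /(map_f (fun e => ((e.1, pt e.1), (e.2, pt e.2))))/uvP wxP.
  rewrite -(map_inj_uniq val_inj) /= => uvwx; move: wxP; rewrite /= uvwx /=.
  rewrite !orientE -!rmorphM.
  by case: ifP => [h _|_ h]; [left | right]; apply: embZ_gt0.
Qed.

(* Vertices [0] and [1] are the two poles, [6 * i + 2] for [i <= 12] are their
   common neighbours separating the twelve sectors, and the five inner vertices
   of sector [i] are [6 * i + 3], ..., [6 * i + 7]. *)
Definition sector_edges (i : nat) : seq (nat * nat) :=
  let x := (6 * i + 2)%N in
  let: (p, q, z, r, s, y) := (x.+1, x.+2, x.+3, x.+4, x.+4.+1, x.+4.+2) in
  [:: (0, x); (1, x); (0, y); (1, y); (0, z); (1, z);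
      (0, p); (1, q); (x, p); (x, q); (p, q); (p, z); (q, z);
      (0, s); (1, r); (y, s); (y, r); (s, r); (s, z); (r, z)]%N.

(** Consecutive sectors share a vertex and its two edges to the poles; [undup] removes these
    repetitions. *)
Definition gutner_arcs : seq (nat * nat) :=
  let es := (0, 1)%N :: flatten [seq sector_edges i | i <- iota 0 12] in
  undup (es ++ [seq (e.2, e.1) | e <- es]).

Lemma gutner_arcs_sym : all (fun e => (e.2, e.1) \in gutner_arcs) gutner_arcs.
Proof. by vm_compute. Qed.

Lemma gutner_arcs_irrefl : all (fun e => e.1 != e.2) gutner_arcs.
Proof. by vm_compute. Qed.

Definition gutner_graph : sgraph :=
  SGraph (@arc_rel_sym 75 _ gutner_arcs_sym)
         (@arc_rel_irrefl 75 _ gutner_arcs_irrefl).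

(** The poles are high enough for their edges to be steep near the axis. These edges lean left, so
    [r] and [s] are kept at height 2 in absolute value; with 3, [p], [z], [r] would moreover be
    collinear. *)
Definition gutner_point (n : nat) : Z * Z :=
  if n is m.+2 then
    let d := nth (0, 0) [:: (0, 0); (1, 3); (1, -3); (3, 0); (5, -2); (5, 2)]
               (m %% 6) in
    (Z.of_nat (6 * (m %/ 6) + 6) + d.1, d.2)
  else (0, if n is 0 then 200 else -200).

Lemma gutner_planar (R : realType) : planar R gutner_graph.
Proof. by apply: (@separated_planar R 75 _ gutner_point); vm_compute. Qed.

(** * The lists and the impossibility of a coloring *)

Definition pole_colors : seq (nat * nat) :=
  [seq ab <- [seq (a, b) | a <- iota 0 4, b <- iota 0 4] | ab.1 != ab.2].

(** Vertex 74 reads past the end of [pole_colors], harmlessly: its residue is 0, where the list does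
    not depend on the pair. *)
Definition gutner_list (n : nat) : seq nat :=
  if n is m.+2 then
    let: (a, b) := nth (0, 0)%N pole_colors (m %/ 6) in
    nth [::] [:: iota 0 4; rem b (iota 0 5); rem a (iota 0 5); [:: a; b; 4; 5];
                 rem a [:: 0; 1; 2; 3; 5]; rem b [:: 0; 1; 2; 3; 5]]%N (m %% 6)
  else iota 0 4.

(* Besides [e], only one color is left for [p] and [q]. *)
Lemma half_sector (e a b x p q z : nat) :
  e \in [:: 4; 5]%N -> a \in iota 0 4 -> b \in iota 0 4 -> x \in iota 0 4 ->
  p \in rem b (rcons (iota 0 4) e) -> q \in rem a (rcons (iota 0 4) e) ->
  a != b -> a != x -> b != x -> a != p -> b != q -> x != p -> x != q ->
  p != q -> p != z -> q != z -> z != e.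
Proof.
move=> he ha hb hx hp hq ab ax bx ap bq xp xq pq pz qz.
suff /orP[/eqP <-|/eqP <-] : (p == e) || (q == e) by rewrite eq_sym.
have /allP/(_ _ he)/allP/(_ _ ha)/allP/(_ _ hb)/allP/(_ _ hx)/allP/(_ _ hp)
     /allP/(_ _ hq) : all (fun e => all (fun a => all (fun b => all (fun x =>
    all (fun p => all (fun q =>
      [&& a != b, a != x, b != x, a != p & b != q] ==>
      [&& x != p, x != q & p != q] ==> (p == e) || (q == e))
    (rem a (rcons (iota 0 4) e))) (rem b (rcons (iota 0 4) e)))
    (iota 0 4)) (iota 0 4)) (iota 0 4)) [:: 4; 5]%N by vm_compute.
by rewrite ab ax bx ap bq xp xq pq.
Qed.

Lemma gutner_listE (i : nat) (a b : nat) :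
  nth (0, 0)%N pole_colors i = (a, b) ->
  [/\ gutner_list (6 * i + 2) = iota 0 4,
      gutner_list (6 * i + 2).+1 = rem b (iota 0 5),
      gutner_list (6 * i + 2).+2 = rem a (iota 0 5)
    & [/\ gutner_list (6 * i + 2).+3 = [:: a; b; 4; 5]%N,
      gutner_list (6 * i + 2).+4 = rem a [:: 0; 1; 2; 3; 5]%N,
      gutner_list (6 * i + 2).+4.+1 = rem b [:: 0; 1; 2; 3; 5]%N
    & gutner_list (6 * i + 2).+4.+2 = iota 0 4]].
Proof.
move=> iab; have E j : (j < 6)%N -> gutner_list (6 * i + j).+2 =
    nth [::] [:: iota 0 4; rem b (iota 0 5); rem a (iota 0 5); [:: a; b; 4; 5];
                 rem a [:: 0; 1; 2; 3; 5]; rem b [:: 0; 1; 2; 3; 5]]%N j.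
  move=> j6; rewrite /gutner_list mulnC modnMDl divnMDl // divn_small // addn0.
  by rewrite iab modn_small.
(* This vertex opens the next block, whose color pair is irrelevant here. *)
have L6 : gutner_list (6 * i + 6).+2 = iota 0 4.
  rewrite /gutner_list -mulnSr mulnC modnMl.
  by case: (nth _ _ _).
by move: (E 0%N isT) (E 1%N isT) (E 2%N isT) (E 3%N isT) (E 4%N isT) (E 5%N isT) L6;
  rewrite !addnS addn0 => -> -> -> -> -> -> ->.
Qed.

Lemma gutner_no_coloring (k : nat -> nat) :
  (forall n, (n < 75)%N -> k n \in gutner_list n) ->
  (forall e, e \in gutner_arcs -> k e.1 != k e.2) -> False.
Proof.
move=> kL kE.
have [k0 k1] : k 0%N \in iota 0 4 /\ k 1%N \in iota 0 4.
  by split; [exact: (kL 0%N) | exact: (kL 1%N)].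
have k01 : k 0%N != k 1%N by apply: (kE (0, 1)%N); vm_compute.
(* The colors of the poles select the sector that cannot be colored. *)
have [i i12 iE] : exists2 i, (i < 12)%N &
    nth (0, 0)%N pole_colors i = (k 0%N, k 1%N).
  have ab : (k 0%N, k 1%N) \in pole_colors.
    by rewrite mem_filter k01; apply/allpairsP; exists (k 0%N, k 1%N).
  exists (index (k 0%N, k 1%N) pole_colors); last exact: nth_index.
  by rewrite -index_mem in ab.
have sub : all (fun i => all [in gutner_arcs] (sector_edges i)) (iota 0 12).
  by vm_compute.
have i_in : i \in iota 0 12 by rewrite mem_iota.
have {}sub := allP (allP sub _ i_in).
have : all (fun e => k e.1 != k e.2) (sector_edges i).
  by apply/allP => e /sub/kE.
have [Lx Lp Lq [Lz Lr Ls Ly]] := gutner_listE iE.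
have lt75 j : (j <= 6)%N -> (j + (6 * i + 2) < 75)%N by lia.
have kx := kL _ (lt75 0%N isT); rewrite Lx in kx.
have kp := kL _ (lt75 1%N isT); rewrite Lp in kp.
have kq := kL _ (lt75 2%N isT); rewrite Lq in kq.
have kz := kL _ (lt75 3%N isT); rewrite Lz in kz.
have kr := kL _ (lt75 4%N isT); rewrite Lr in kr.
have ks := kL _ (lt75 5%N isT); rewrite Ls in ks.
have ky := kL _ (lt75 6%N isT); rewrite Ly in ky.
rewrite /= => /and5P[ux vx uy vy] /and5P[uz vz up vq] /and5P[xp xq pq pz].
move=> /and5P[qz us vr ys] /and5P[yr sr sz rz _].
have z4 := half_sector (e := 4) isT k0 k1 kx kp kq k01 ux vx up vq xp xq pq pz qz.
(* In the mirrored half, [s] and [r] take the places of [p] and [q]. *)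
have z5 := half_sector (e := 5) isT k0 k1 ky ks kr k01 uy vy us vr ys yr sr sz rz.
move: kz; rewrite !inE (negPf z4) (negPf z5) !orbF => /orP[] /eqP E.
  by rewrite E eqxx in uz.
by rewrite E eqxx in vz.
Qed.

Lemma gutner_not_choosable : ~ choosable 4 gutner_graph.
Proof.
pose S (v : gutner_graph) :=
  [fset c in [seq Posz c | c <- gutner_list (val v)]]%fset.
move=> /(_ S) []; rewrite /S.
  move=> v; rewrite card_fseq undup_id.
    have /allP sz : all (fun n => size (gutner_list n) == 4) (iota 0 75).
      by vm_compute.
    by rewrite size_map; apply/eqP/sz; rewrite mem_iota ltn_ord.
  rewrite map_inj_uniq; last by move=> a b [].
  have /allP un : all (fun n => uniq (gutner_list n)) (iota 0 75).
    by vm_compute.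
  by apply: un; rewrite mem_iota ltn_ord.
move=> c [c_proper cS].
have {}cS v : exists2 a, a \in gutner_list (val v) & c v = Posz a.
  by have := cS v; rewrite in_fset => /mapP.
(* Absolute values lose nothing, since every list color is a natural number. *)
apply: (@gutner_no_coloring (fun n => `|c (inord n)|%N)).
  move=> n n75; have [a] := cS (inord n : 'I_75).
  by rewrite /= inordK // => aL ->.
have bnd : all (fun e => (e.1 < 75) && (e.2 < 75))%N gutner_arcs by vm_compute.
move=> e eA; have /andP[e1 e2] := allP bnd _ eA.
have /c_proper : @adj gutner_graph (inord e.1) (inord e.2).
  by rewrite /= /arc_rel /= !inordK // -surjective_pairing.
have [a _ ->] := cS (inord e.1 : 'I_75); have [b _ ->] := cS (inord e.2 : 'I_75).
by move=> ab; apply/eqP => /= E; apply: ab; rewrite E.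
Qed.

Local Close Scope ring_scope.
Local Close Scope classical_set_scope.

Theorem theorem1p7 (R : realType) :
  exists G : sgraph, [/\ #|G| = 75, planar R G & ~ choosable 4 G].
Proof.
exists gutner_graph; split; [exact: card_ord | exact: gutner_planar |].
exact: gutner_not_choosable.
Qed.
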